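(* There is no invertible quadratic transformation of $\mathbb R^2$ whose associated quadratic form $\omega_1$ is definite. That is, if $f:\mathbb R^2\to\mathbb R^2$, $(p,q)\mapsto(\tilde p,\tilde q)$, is given by $$\tilde p=a_{20}p^2+2a_{11}pq+a_{02}q^2+2a_{10}p+2a_{01}q+a_{00},$$ $$\tilde q=b_{20}p^2+2b_{11}pq+b_{02}q^2+2b_{10}p+2b_{01}q+b_{00}$$ with real coefficients, and the associated quadratic form $\omega_1$ is definite, then $f$ is not invertible.
   Context: A transformation of $\mathbb R^2$ is called invertible if it is a bijection $\mathbb R^2\to\mathbb R^2$. The quadratic form associated with the quadratic transformation is the form on $\mathbb R^2$ given, for $\mathbf c=(c_1,c_2)\in\mathbb R^2$, by $$\omega_1(\mathbf c)=(a_{20}b_{11}-a_{11}b_{20})\,c_1^2+(a_{20}b_{02}-a_{02}b_{20})\,c_1c_2+(a_{11}b_{02}-a_{02}b_{11})\,c_2^2 .$$ A real quadratic form is definite if it is either positive definite or negative definite. *)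

(* Defs.v *)
From mathcomp Require Import all_boot all_order all_algebra.
From mathcomp Require Import reals.

Set Implicit Arguments.
Unset Strict Implicit.
Unset Printing Implicit Defensive.

Import Order.TTheory GRing.Theory Num.Theory.
Local Open Scope ring_scope.

Definition quadratic_transformation (R : realType)
    (a20 a11 a02 a10 a01 a00 b20 b11 b02 b10 b01 b00 : R) (x : R * R) : R * R :=
  let: (p, q) := x in
  (a20 * p ^+ 2 + 2 * a11 * p * q + a02 * q ^+ 2
     + 2 * a10 * p + 2 * a01 * q + a00,
   b20 * p ^+ 2 + 2 * b11 * p * q + b02 * q ^+ 2
     + 2 * b10 * p + 2 * b01 * q + b00).

(* Only the coefficients of degree 2 of the transformation are involved. *)
Definition omega1 (R : realType)
    (a20 a11 a02 b20 b11 b02 : R) (c : R * R) : R :=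
  let: (c1, c2) := c in
  (a20 * b11 - a11 * b20) * c1 ^+ 2
  + (a20 * b02 - a02 * b20) * (c1 * c2)
  + (a11 * b02 - a02 * b11) * c2 ^+ 2.

Definition positive_definite (R : realType) (w : R * R -> R) : Prop :=
  forall c : R * R, c <> (0, 0) -> 0 < w c.

Definition negative_definite (R : realType) (w : R * R -> R) : Prop :=
  forall c : R * R, c <> (0, 0) -> w c < 0.

Definition definite (R : realType) (w : R * R -> R) : Prop :=
  positive_definite w \/ negative_definite w.

(* Main.v *)
(* For a quadratic map f, the difference f (x + h) - f (x - h) is affine in x,
   and the determinant of its linear part is a nonzero multiple of omega1 h.
   When omega1 h <> 0 it therefore vanishes at some x, so that f takes the same
   value at the distinct points x + h and x - h. The choice h = (1, 0) suffices:
   omega1 (1, 0) is the leading coefficient of omega1. *)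
Require Import Defs.
From mathcomp Require Import all_boot all_order all_algebra.
From mathcomp Require Import reals.
From mathcomp Require Import ring.

Import Order.TTheory GRing.Theory Num.Theory.

Local Open Scope ring_scope.

Lemma definite_neq0 (R : realType) (w : R * R -> R) (c : R * R) :
  definite w -> c <> (0, 0) -> w c != 0.
Proof.
by move=> [w_gt0 | w_lt0] c_neq0; [rewrite gt_eqF ?w_gt0 | rewrite lt_eqF ?w_lt0].
Qed.

Lemma quadratic_transformation_not_injective (R : realType)
    (a20 a11 a02 a10 a01 a00 b20 b11 b02 b10 b01 b00 : R) :
  a20 * b11 - a11 * b20 != 0 ->
  ~ injective (quadratic_transformation a20 a11 a02 a10 a01 a00
                                        b20 b11 b02 b10 b01 b00).
Proof.
move=> d_neq0 f_inj.
(* The coordinates of f (p + 1, q) - f (p - 1, q) are 4 (a20 p + a11 q + a10) and 4 (b20 p + b11 q +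
   b10). Cramer's rule gives their common zero (p, q); the denominator is the determinant of this
   linear system. *)
pose p := (a11 * b10 - a10 * b11) / (a20 * b11 - a11 * b20).
pose q := (a10 * b20 - a20 * b10) / (a20 * b11 - a11 * b20).
have /f_inj[/addrI/eqP] :
    quadratic_transformation a20 a11 a02 a10 a01 a00 b20 b11 b02 b10 b01 b00 (p + 1, q) =
    quadratic_transformation a20 a11 a02 a10 a01 a00 b20 b11 b02 b10 b01 b00 (p - 1, q).
  by rewrite /quadratic_transformation /p /q; congr pair; field.
(* Cancelling [p] in the first coordinates leaves 1 = -1, which the order of [R] excludes. *)
by rewrite gt_eqF // (lt_trans (ltrN10 R) ltr01).
Qed.

Theorem theorem6p1 (R : realType)
    (a20 a11 a02 a10 a01 a00 b20 b11 b02 b10 b01 b00 : R) :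
  definite (omega1 a20 a11 a02 b20 b11 b02) ->
  ~ bijective (quadratic_transformation a20 a11 a02 a10 a01 a00
                                        b20 b11 b02 b10 b01 b00).
Proof.
move=> w_def /bij_inj; apply: quadratic_transformation_not_injective.
have e1_neq0 : (1, 0) <> (0, 0) :> R * R by case=> /eqP; rewrite oner_eq0.
have := definite_neq0 _ _ _ w_def e1_neq0.
by rewrite /omega1 expr1n expr0n /= !mulr0 mulr1 !addr0.
Qed.
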